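(* Let $e,f\in\mathbb{R}$, not both zero, and let $\alpha^*=\alpha+\lambda B$ be a $B$-$R^*$ associated curve of $\alpha$ (with respect to $e,f$). Put $$X=-\lambda\tau(-\lambda\tau^2+\lambda'')-\lambda'(-\lambda\tau'-2\lambda'\tau+\kappa),\quad Y=\lambda\tau^2-\lambda''+\lambda'\lambda\tau\kappa,\quad Z=-\lambda\tau'-2\lambda'\tau+\kappa+\lambda^2\tau^2\kappa.$$ Then, where the denominators below do not vanish, the curvature $\kappa^*$ and the torsion $\tau^*$ of $\alpha^*$ are $$\kappa^*=\frac{Z\,e^3}{f(e^2+f^2)(\lambda')^3},$$ $$\tau^*=\frac{f^2}{Z^2(e^2+f^2)}\Big(X\big(\lambda\tau\kappa'+2\lambda\tau'\kappa+3\lambda'\tau\kappa-\kappa^2\big)+Y\big(\lambda\tau\kappa^2+\lambda\tau^3-\lambda\tau''-3\lambda''\tau-3\lambda'\tau'+\kappa'\big)+Z\big(-3\lambda\tau\tau'-3\lambda'\tau^2+\kappa\tau+\lambda'''\big)\Big).$$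
   Context: $\alpha$ is a smooth curve in $E^3$ parametrized by arc length $s$, with Frenet frame $\{T,N,B\}$, curvature $\kappa>0$ and torsion $\tau$: $T'=\kappa N$, $N'=-\kappa T+\tau B$, $B'=-\tau N$. For a curve $\alpha^*$ with the same parameter $s$ (regular, not necessarily unit speed, with ${\alpha^*}'\wedge{\alpha^*}''\ne 0$), $T^*={\alpha^*}'/\|{\alpha^*}'\|$, $B^*=({\alpha^*}'\wedge{\alpha^*}'')/\|{\alpha^*}'\wedge{\alpha^*}''\|$, $N^*=B^*\wedge T^*$, $\kappa^*=\|{\alpha^*}'\wedge{\alpha^*}''\|/\|{\alpha^*}'\|^3$, $\tau^*=\langle{\alpha^*}'\wedge{\alpha^*}'',{\alpha^*}'''\rangle/\|{\alpha^*}'\wedge{\alpha^*}''\|^2$. For real constants $e,f$ put $R^*=\frac{eT^*+fB^*}{\sqrt{e^2+f^2}}$. The curve $\alpha^*$ is called a $B$-$R^*$ associated curve of $\alpha$ if $\alpha^*=\alpha+\lambda B$ for a smooth real function $\lambda$ of $s$ and $B$ is linearly dependent with $R^*$, normalized so that $B=R^*$. *)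

(* Defs.v *)
From mathcomp Require Import all_boot all_order all_algebra.
From mathcomp Require Import all_classical all_reals all_analysis.

Set Implicit Arguments.
Unset Strict Implicit.
Unset Printing Implicit Defensive.

Import Order.TTheory GRing.Theory Num.Theory.
Import numFieldNormedType.Exports.

Local Open Scope ring_scope.
Local Open Scope classical_set_scope.

(* Euclidean 3-space is 'rV[R]_3.  The library norm `|u| on row vectors is the
   sup norm: it only serves to define derivatives, on which the choice of norm
   has no influence.  Lengths are measured by [enorm]. *)
Definition dot (R : realType) (u v : 'rV[R]_3) : R := \sum_(i < 3) u 0 i * v 0 i.

Definition enorm (R : realType) (u : 'rV[R]_3) : R := Num.sqrt (dot u u).

Definition cross (R : realType) (u v : 'rV[R]_3) : 'rV[R]_3 :=
  \row_(i < 3) [:: u 0 1 * v 0 2 - u 0 2 * v 0 1;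
                   u 0 2 * v 0 0 - u 0 0 * v 0 2;
                   u 0 0 * v 0 1 - u 0 1 * v 0 0]`_i.

Definition open_interval (R : realType) (I : set R) : Prop :=
  open I /\ is_interval I.

Definition smooth_on (R : realType) (V : normedModType R) (I : set R)
    (f : R -> V) : Prop :=
  forall (n : nat) (s : R), I s -> derivable (derive1n n f) s 1.

Section UnitSpeedCurve.
Variables (R : realType) (alpha : R -> 'rV[R]_3).

(* Frenet apparatus of a curve parametrized by arc length, with kappa > 0:
   kappa, N and tau are read off T' = kappa N and B' = - tau N. *)
Definition tangent : R -> 'rV[R]_3 := derive1 alpha.
Definition curvature (s : R) : R := enorm (derive1 tangent s).
Definition normal (s : R) : 'rV[R]_3 := (curvature s)^-1 *: derive1 tangent s.
Definition binormal (s : R) : 'rV[R]_3 := cross (tangent s) (normal s).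
Definition torsion (s : R) : R := - dot (derive1 binormal s) (normal s).

Record unit_speed_frenet_curve (I : set R) : Prop := {
  usfc_smooth : smooth_on I alpha;
  usfc_unit_speed : forall s, I s -> enorm (derive1 alpha s) = 1;
  usfc_curvature_gt0 : forall s, I s -> 0 < curvature s
}.

End UnitSpeedCurve.

Section RegularCurve.
Variables (R : realType) (beta : R -> 'rV[R]_3).

(* Frenet apparatus of a regular curve in an arbitrary parametrization. *)
Definition reg_cross (s : R) : 'rV[R]_3 :=
  cross (derive1 beta s) (derive1n 2 beta s).
Definition reg_tangent (s : R) : 'rV[R]_3 :=
  (enorm (derive1 beta s))^-1 *: derive1 beta s.
Definition reg_binormal (s : R) : 'rV[R]_3 :=
  (enorm (reg_cross s))^-1 *: reg_cross s.
Definition reg_curvature (s : R) : R :=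
  enorm (reg_cross s) / enorm (derive1 beta s) ^+ 3.
Definition reg_torsion (s : R) : R :=
  dot (reg_cross s) (derive1n 3 beta s) / enorm (reg_cross s) ^+ 2.

Record regular_frenet_curve (I : set R) : Prop := {
  rfc_regular : forall s, I s -> derive1 beta s != 0;
  rfc_cross_neq0 : forall s, I s -> reg_cross s != 0
}.

Definition Rstar (e f : R) (s : R) : 'rV[R]_3 :=
  (Num.sqrt (e ^+ 2 + f ^+ 2))^-1 *:
    (e *: reg_tangent s + f *: reg_binormal s).

End RegularCurve.

Record BRstar_associated (R : realType) (I : set R) (e f : R)
    (alpha : R -> 'rV[R]_3) (lambda : R -> R) (alphas : R -> 'rV[R]_3)
    : Prop := {
  BRstar_smooth : smooth_on I lambda;
  BRstar_curve : forall s, I s ->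
    alphas s = alpha s + lambda s *: binormal alpha s;
  BRstar_regular : regular_frenet_curve alphas I;
  BRstar_direction : forall s, I s -> binormal alpha s = Rstar alphas e f s
}.

(* Main.v *)
(* In the Frenet frame (T, N, B) of alpha, the Frenet equations give
     alpha*' = T - lambda tau N + lambda' B,
     alpha*' x alpha*'' = X T + Y N + Z B,
   and the bracket in tau* is the product of this last vector with alpha*'''.
   Pairing B = R* with these two vectors yields, for r = sqrt (e^2 + f^2),
     lambda' = e |alpha*'| / r   and   Z = f |alpha*' x alpha*''| / r,
   which turns the two norms in kappa* and tau* into lambda' and Z. *)
Require Import Defs.
From mathcomp Require Import all_boot all_order all_algebra.
From mathcomp Require Import all_classical all_reals all_analysis.
From mathcomp Require Import ring.
Import Order.TTheory GRing.Theory Num.Theory.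
Import numFieldNormedType.Exports.
Local Open Scope ring_scope.
Local Open Scope classical_set_scope.

Set Implicit Arguments.
Unset Strict Implicit.
Unset Printing Implicit Defensive.

(** * Dot and cross products in coordinates; orthonormal frames *)

Section VectorAlgebra.
Variable R : realType.
Implicit Types (u v w T N B : 'rV[R]_3) (a b c : R).

Lemma row3P u v :
  u 0 0 = v 0 0 -> u 0 1 = v 0 1 -> u 0 2 = v 0 2 -> u = v.
Proof.
move=> h0 h1 h2; apply/rowP => -[[|[|[|//]]] i].
- by rewrite (_ : Ordinal i = 0) //; apply/val_inj.
- by rewrite (_ : Ordinal i = 1) //; apply/val_inj.
- by rewrite (_ : Ordinal i = 2) //; apply/val_inj.
Qed.

Lemma dotE u v : dot u v = u 0 0 * v 0 0 + u 0 1 * v 0 1 + u 0 2 * v 0 2.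
Proof.
rewrite /dot !big_ord_recl big_ord0 addr0 addrA.
by congr (_ + u 0 _ * v 0 _ + u 0 _ * v 0 _); apply/val_inj.
Qed.

Lemma crossE u v :
  (cross u v 0 0 = u 0 1 * v 0 2 - u 0 2 * v 0 1) *
  (cross u v 0 1 = u 0 2 * v 0 0 - u 0 0 * v 0 2) *
  (cross u v 0 2 = u 0 0 * v 0 1 - u 0 1 * v 0 0).
Proof. by rewrite !mxE. Qed.

Lemma coordD u v i : (u + v) 0 i = u 0 i + v 0 i. Proof. exact: mxE. Qed.
Lemma coordN u i : (- u) 0 i = - u 0 i. Proof. exact: mxE. Qed.
Lemma coordZ a u i : (a *: u) 0 i = a * u 0 i. Proof. exact: mxE. Qed.
Lemma coord0 i : (0 : 'rV[R]_3) 0 i = 0. Proof. exact: mxE. Qed.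

Ltac coords := rewrite ?(dotE, crossE, coordD, coordN, coordZ, coord0); ring.
Ltac vcoords := apply: row3P; coords.

Lemma dotC u v : dot u v = dot v u. Proof. coords. Qed.

Lemma dot_ge0 u : 0 <= dot u u.
Proof. by apply: sumr_ge0 => i _; rewrite -expr2 sqr_ge0. Qed.

Lemma enorm_gt0 u : u != 0 -> 0 < enorm u.
Proof.
apply: contra_neqT; rewrite /enorm sqrtr_gt0 -leNgt => uu.
have /eqP : dot u u = 0 by apply/eqP; rewrite eq_le uu dot_ge0.
rewrite psumr_eq0 => [/allP u0|i _]; last by rewrite -expr2 sqr_ge0.
apply/rowP => i; rewrite mxE; apply/eqP.
by have := u0 i (mem_index_enum _); rewrite mulf_eq0 orbb.
Qed.

Lemma sqr_enorm u : enorm u ^+ 2 = dot u u.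
Proof. exact/sqr_sqrtr/dot_ge0. Qed.

Lemma dotDl u v w : dot (u + v) w = dot u w + dot v w. Proof. coords. Qed.
Lemma dotZl a u v : dot (a *: u) v = a * dot u v. Proof. coords. Qed.
Lemma dotZr a u v : dot u (a *: v) = a * dot u v. Proof. coords. Qed.

Lemma dot_crossl u v : dot (cross u v) u = 0. Proof. coords. Qed.

Lemma crossZl a u v : cross (a *: u) v = a *: cross u v. Proof. vcoords. Qed.
Lemma crossvv u : cross u u = 0. Proof. vcoords. Qed.
Lemma crossC u v : cross u v = - cross v u. Proof. vcoords. Qed.

Lemma cross_crossl u v w : cross (cross u v) w = dot u w *: v - dot v w *: u.
Proof. vcoords. Qed.

Lemma cross_crossr u v w : cross u (cross v w) = dot u w *: v - dot u v *: w.
Proof. vcoords. Qed.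

(** Lagrange's identity: it makes the third vector of the frame a unit vector as soon as the first
    two are orthonormal. *)
Lemma dot_cross_cross u v :
  dot (cross u v) (cross u v) = dot u u * dot v v - dot u v ^+ 2.
Proof. coords. Qed.

(* Gram's identity: the coordinates of [w] in the frame [u, v, u x v]. *)
Lemma frame_expansion u v w :
  dot (cross u v) (cross u v) *: w =
    (dot w u * dot v v - dot w v * dot u v) *: u +
    (dot w v * dot u u - dot w u * dot u v) *: v +
    dot w (cross u v) *: cross u v.
Proof. vcoords. Qed.

(** The third frame vector is a cross product, so for [tangent] and [normal] it is [binormal] by
    definition. A vector is then handled through its three coefficients. *)
Definition frame_comb T N a b c := a *: T + b *: N + c *: cross T N.

Variables T N : 'rV[R]_3.
Hypotheses (TT : dot T T = 1) (NN : dot N N = 1) (TN : dot T N = 0).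

Lemma orthonormal_expansion w :
  w = frame_comb T N (dot w T) (dot w N) (dot w (cross T N)).
Proof.
have := frame_expansion T N w.
by rewrite dot_cross_cross TT NN TN expr0n /= !mulr1 !mulr0 !subr0 scale1r.
Qed.

Lemma dot_frame_comb a b c a' b' c' :
  dot (frame_comb T N a b c) (frame_comb T N a' b' c')
    = a * a' + b * b' + c * c'.
Proof.
(* For arbitrary [T] and [N] this is a polynomial identity in the coordinates, within reach of
   [ring]; orthonormality is substituted afterwards. *)
have -> : dot (frame_comb T N a b c) (frame_comb T N a' b' c') =
  a * a' * dot T T + b * b' * dot N N
  + c * c' * (dot T T * dot N N - dot T N ^+ 2)
  + (a * b' + b * a') * dot T N by rewrite /frame_comb; coords.
by rewrite TT NN TN; ring.
Qed.

Lemma cross_frame_comb a b c a' b' c' :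
  cross (frame_comb T N a b c) (frame_comb T N a' b' c')
    = frame_comb T N (b * c' - c * b') (c * a' - a * c') (a * b' - b * a').
Proof.
(* Only bilinearity and antisymmetry are used here. The triple product formulas then give N x B = T
   and B x T = N. *)
have -> : cross (frame_comb T N a b c) (frame_comb T N a' b' c') =
  (b * c' - c * b') *: cross N (cross T N)
  + (c * a' - a * c') *: cross (cross T N) T
  + (a * b' - b * a') *: cross T N.
  rewrite /frame_comb; set B := cross T N; vcoords.
rewrite cross_crossl cross_crossr TT NN [dot N T]dotC TN.
by rewrite !scale1r !scale0r !subr0.
Qed.

End VectorAlgebra.

(** * Smoothness on an open set and rules of derivation *)

Section Smoothness.
Variables (R : realType) (I : set R).
Hypothesis openI : open I.
Implicit Type s : R.

Lemma near_open (V : Type) (f g : R -> V) :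
  {in I, f =1 g} -> forall s, I s -> \near s, f s = g s.
Proof.
move=> fg s Is; have := open_nbhs_nbhs (conj openI Is).
by apply: filterS => x Ix; apply/fg/mem_set.
Qed.

Lemma eq_is_derive (V : normedModType R) (f g : R -> V) (df : V) s :
  {in I, f =1 g} -> I s -> is_derive s 1 f df -> is_derive s 1 g df.
Proof. by move=> fg Is; exact/near_eq_is_derive/near_open. Qed.

Lemma is_derive_derive1 (V : normedModType R) (f : R -> V) (df : V) s :
  is_derive s 1 f df -> f^`() s = df.
Proof. by move=> [_ <-]; rewrite derive1E. Qed.

Lemma derivable_is_derive1 (V : normedModType R) (f : R -> V) s :
  derivable f s 1 -> is_derive s 1 f (f^`() s).
Proof. by move=> fs; rewrite derive1E; exact: derivableP. Qed.

Lemma is_derive_mxP (m n : nat) (M : R -> 'M[R]_(m, n)) (dM : 'M[R]_(m, n)) s :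
  is_derive s 1 M dM <->
  forall i j, is_derive s 1 (fun x => M x i j) (dM i j).
Proof.
split=> [[Ms <-] i j|Ms].
  have Mij := (derivable_mxP M s 1).1 Ms i j.
  by split=> //; rewrite derive_mx // mxE.
have Md : derivable M s 1 by apply/derivable_mxP => i j; case: (Ms i j).
split=> //; rewrite derive_mx //; apply/matrixP => i j; rewrite mxE.
by case: (Ms i j).
Qed.

(** Smoothness is known on [I] only, so the two sides are compared there; since [I] is open, an
    equality on [I] can be differentiated, which carries the induction on [k]. *)
Lemma derive1n_mx (m n k : nat) (M : R -> 'M[R]_(m, n)) i j :
  smooth_on I M ->
  {in I, (fun x => derive1n k M x i j) =1 derive1n k (fun x => M x i j)}.
Proof.
move=> Msm; elim: k => [//|k IHk] s /set_mem Is.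
have /is_derive_mxP /(_ i j) Mij := derivable_is_derive1 (Msm k s Is).
by rewrite -(is_derive_derive1 (eq_is_derive IHk Is Mij)).
Qed.

Lemma smooth_on_mx (m n : nat) (M : R -> 'M[R]_(m, n)) i j :
  smooth_on I M -> smooth_on I (fun x => M x i j).
Proof.
move=> Msm k s Is.
have /is_derive_mxP /(_ i j) Mij := derivable_is_derive1 (Msm k s Is).
by case: (eq_is_derive (@derive1n_mx _ _ k M i j Msm) Is Mij).
Qed.

Lemma smooth_on_derive1 (V : normedModType R) (f : R -> V) :
  smooth_on I f -> smooth_on I f^`().
Proof. by move=> fsm n s Is; rewrite -derive1Sn; exact: fsm. Qed.

(* This algebra of functions is closed under derivation, so its members are
   smooth without any Leibniz or Faa di Bruno formula. *)
Inductive smooth_closure : (R -> R) -> Prop :=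
| smooth_closure_smooth f : smooth_on I f -> smooth_closure f
| smooth_closure_eq f g : {in I, f =1 g} -> smooth_closure f -> smooth_closure g
| smooth_closure_cst c : smooth_closure (fun=> c)
| smooth_closureD f g :
    smooth_closure f -> smooth_closure g -> smooth_closure (fun x => f x + g x)
| smooth_closureM f g :
    smooth_closure f -> smooth_closure g -> smooth_closure (fun x => f x * g x)
| smooth_closureV f :
    (forall s, I s -> f s != 0) -> smooth_closure f ->
    smooth_closure (fun x => (f x)^-1)
| smooth_closure_sqrt f :
    (forall s, I s -> 0 < f s) -> smooth_closure f ->
    smooth_closure (fun x => Num.sqrt (f x)).

Lemma smooth_closureN f : smooth_closure f -> smooth_closure (fun x => - f x).
Proof.
move=> fsm; apply: (@smooth_closure_eq (fun x => -1 * f x)) => [x _|].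
  exact: mulN1r.
exact/smooth_closureM/fsm/smooth_closure_cst.
Qed.

(** This rule and its analogues below are stated for explicit pointwise expressions, so that they
    compose directly on concrete formulas. *)
Lemma is_derive_addf (V : normedModType R) (f g : R -> V) (df dg : V) s :
  is_derive s 1 f df -> is_derive s 1 g dg ->
  is_derive s 1 (fun x => f x + g x) (df + dg).
Proof. by move=> *; exact: is_deriveD. Qed.

Lemma is_derive_mulf (f g : R -> R) (df dg : R) s :
  is_derive s 1 f df -> is_derive s 1 g dg ->
  is_derive s 1 (fun x => f x * g x) (df * g s + f s * dg).
Proof.
move=> fs gs; apply: is_derive_eq (is_deriveM fs gs) _.
by rewrite addrC /GRing.scale /= [g s * _]mulrC.
Qed.

(** Induction on the construction of [f]: each rule of derivation gives an expression built by the
    same constructors. The side conditions of the inverse and the square root are what their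
    derivatives need in order to exist and to stay in the algebra. *)
Lemma smooth_closure_derive f : smooth_closure f ->
  exists2 df, smooth_closure df & forall s, I s -> is_derive s 1 f (df s).
Proof.
elim=> {f} [f fsm|f g fg _ [df dfsm fdf]|c|f g fsm [df dfsm fdf] gsm
  [dg dgsm gdg]|f g fsm [df dfsm fdf] gsm [dg dgsm gdg]
  |f f0 fsm [df dfsm fdf]|f f0 fsm [df dfsm fdf]].
- exists f^`(); first exact/smooth_closure_smooth/smooth_on_derive1.
  by move=> s Is; exact/derivable_is_derive1/(fsm 0).
- by exists df => // s Is; exact: (eq_is_derive fg Is (fdf s Is)).
- exists (fun=> 0); first exact: smooth_closure_cst.
  by move=> s _; exact: is_derive_cst.
- exists (fun x => df x + dg x); first exact: smooth_closureD.
  by move=> s Is; exact: is_derive_addf (fdf s Is) (gdg s Is).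
- exists (fun x => df x * g x + f x * dg x).
    by apply: smooth_closureD; apply: smooth_closureM.
  by move=> s Is; exact: is_derive_mulf (fdf s Is) (gdg s Is).
- exists (fun x => - ((f x)^-1 * (f x)^-1) * df x).
    apply: smooth_closureM => //; apply: smooth_closureN.
    by apply: smooth_closureM; apply: smooth_closureV.
  move=> s Is; apply: is_derive_eq (is_deriveV (f0 s Is) (fdf s Is)) _.
  by rewrite /GRing.scale /= expr2 invfM.
- exists (fun x => (2 * Num.sqrt (f x))^-1 * df x).
    apply: smooth_closureM => //; apply: smooth_closureV => [s Is|].
      by rewrite mulf_neq0 // gt_eqF // sqrtr_gt0 f0.
    apply: smooth_closureM; first exact: smooth_closure_cst.
    exact: smooth_closure_sqrt.
  move=> s Is; have sqs := is_derive1_sqrt (f0 s Is).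
  exact: is_derive1_comp sqs (fdf s Is).
Qed.

Lemma smooth_closure_is_derive1 f s :
  smooth_closure f -> I s -> is_derive s 1 f (f^`() s).
Proof.
move=> /smooth_closure_derive[df _ fdf] Is.
by rewrite (is_derive_derive1 (fdf s Is)); exact: fdf.
Qed.

Lemma smooth_closure_derive1 f : smooth_closure f -> smooth_closure f^`().
Proof.
move=> /smooth_closure_derive[df dfsm fdf]; apply: smooth_closure_eq dfsm.
by move=> s /set_mem Is; rewrite (is_derive_derive1 (fdf s Is)).
Qed.

Lemma is_derive_scalef (m n : nat) (a : R -> R) (M : R -> 'M[R]_(m, n))
    da dM s :
  is_derive s 1 a da -> is_derive s 1 M dM ->
  is_derive s 1 (fun x => a x *: M x) (da *: M s + a s *: dM).
Proof.
move=> ads /is_derive_mxP Mds; apply/is_derive_mxP => i j; rewrite !mxE.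
by under eq_fun do rewrite mxE; exact: is_derive_mulf.
Qed.

Lemma is_derive_dot (u v : R -> 'rV[R]_3) du dv s :
  is_derive s 1 u du -> is_derive s 1 v dv ->
  is_derive s 1 (fun x => dot (u x) (v x)) (dot du (v s) + dot (u s) dv).
Proof.
move=> /is_derive_mxP uds /is_derive_mxP vds.
under eq_fun do rewrite dotE.
have uv i := is_derive_mulf (uds 0 i) (vds 0 i).
apply: is_derive_eq (is_derive_addf (is_derive_addf (uv 0) (uv 1)) (uv 2)) _.
by rewrite !dotE; ring.
Qed.

Lemma is_derive_oppf (f : R -> R) (df : R) s :
  is_derive s 1 f df -> is_derive s 1 (fun x => - f x) (- df).
Proof. by move=> fs; exact: is_deriveN. Qed.

Lemma is_derive_subf (f g : R -> R) (df dg : R) s :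
  is_derive s 1 f df -> is_derive s 1 g dg ->
  is_derive s 1 (fun x => f x - g x) (df - dg).
Proof. by move=> *; exact: is_deriveB. Qed.

Lemma is_derive_cross (u v : R -> 'rV[R]_3) du dv s :
  is_derive s 1 u du -> is_derive s 1 v dv ->
  is_derive s 1 (fun x => cross (u x) (v x)) (cross du (v s) + cross (u s) dv).
Proof.
move=> /is_derive_mxP uds /is_derive_mxP vds; apply/is_derive_mxP => i j.
(* One index pattern covers the three coordinates of a cross product. *)
have dcomp p q r t : is_derive s 1
    (fun x => u x 0 p * v x 0 q - u x 0 r * v x 0 t)
    ((du 0 p * v s 0 q + u s 0 p * dv 0 q)
     - (du 0 r * v s 0 t + u s 0 r * dv 0 t)).
  by apply: is_derive_subf; apply: is_derive_mulf.
rewrite [i]ord1 /cross; under eq_fun do rewrite mxE.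
case: j => -[|[|[|//]]] j /=; apply: is_derive_eq (dcomp _ _ _ _) _;
  by rewrite !mxE /=; ring.
Qed.

End Smoothness.

(** * The Frenet equations of a unit speed curve *)

Section FrenetFrame.
Variables (R : realType) (I : set R) (alpha : R -> 'rV[R]_3).
Hypotheses (openI : open I) (alphaF : unit_speed_frenet_curve alpha I).
Implicit Type s : R.

Local Notation T := (tangent alpha).
Local Notation N := (normal alpha).
Local Notation B := (binormal alpha).
Local Notation kappa := (curvature alpha).
Local Notation tau := (torsion alpha).

Let smoothT : smooth_on I T.
Proof. exact/smooth_on_derive1/usfc_smooth/alphaF. Qed.

Let smoothT1 : smooth_on I T^`().
Proof. exact: smooth_on_derive1. Qed.

Let coord_closure (M : R -> 'rV[R]_3) i :
  smooth_on I M -> smooth_closure I (fun x => M x 0 i).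
Proof. by move=> Msm; apply/smooth_closure_smooth/smooth_on_mx. Qed.

Let closure_dot (u v : R -> 'rV[R]_3) :
  (forall i, smooth_closure I (fun x => u x 0 i)) ->
  (forall i, smooth_closure I (fun x => v x 0 i)) ->
  smooth_closure I (fun x => dot (u x) (v x)).
Proof.
move=> usm vsm; under eq_fun do rewrite dotE.
apply: smooth_closureD; first apply: smooth_closureD.
all: exact: smooth_closureM.
Qed.

Lemma curvature_neq0 s : I s -> kappa s != 0.
Proof. by move=> Is; rewrite gt_eqF // (usfc_curvature_gt0 alphaF). Qed.

(** Positive curvature keeps the radicand of the norm positive on [I], where the square root is
    smooth. *)
Lemma smooth_curvature : smooth_closure I kappa.
Proof.
apply: smooth_closure_sqrt => [s Is|].
  by have := usfc_curvature_gt0 alphaF Is; rewrite sqrtr_gt0.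
by apply: closure_dot => i; apply: coord_closure.
Qed.

Let smoothN i : smooth_closure I (fun x => N x 0 i).
Proof.
rewrite /normal; under eq_fun do rewrite mxE.
apply: smooth_closureM; last exact: coord_closure.
exact/smooth_closureV/smooth_curvature/curvature_neq0.
Qed.

Let smoothB i : smooth_closure I (fun x => B x 0 i).
Proof.
have smoothc p q r t : smooth_closure I
    (fun x => T x 0 p * N x 0 q - T x 0 r * N x 0 t).
  apply: smooth_closureD; last apply: smooth_closureN.
    by apply: smooth_closureM => //; apply: coord_closure.
  by apply: smooth_closureM => //; apply: coord_closure.
rewrite /binormal /cross; under eq_fun do rewrite mxE.
by case: i => -[|[|[|//]]] i /=; exact: smoothc.
Qed.

Let is_derive_closure (M : R -> 'rV[R]_3) s :
  (forall i, smooth_closure I (fun x => M x 0 i)) -> I s ->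
  is_derive s 1 M (M^`() s).
Proof.
move=> Msm Is; apply/derivable_is_derive1/derivable_mxP => i j.
by rewrite [i]ord1; case: (smooth_closure_is_derive1 openI (Msm j) Is).
Qed.

Lemma smooth_torsion : smooth_closure I tau.
Proof.
apply: smooth_closureN; apply: closure_dot => // i.
(* Membership in the algebra concerns scalar functions, so the coordinates of B' are exchanged for
   the derivatives of the coordinates of B, with which they agree on [I]. *)
apply: (smooth_closure_eq _ (smooth_closure_derive1 openI (smoothB i))).
move=> s /set_mem Is; apply: is_derive_derive1.
by have /is_derive_mxP := is_derive_closure smoothB Is.
Qed.

Lemma dot_tangent s : I s -> dot (T s) (T s) = 1.
Proof.
by move=> Is; rewrite -sqr_enorm (usfc_unit_speed alphaF Is) expr1n.
Qed.

Lemma derive1_tangent s : I s -> T^`() s = kappa s *: N s.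
Proof. by move=> Is; rewrite scalerA divff ?scale1r // curvature_neq0. Qed.

Lemma dot_normal s : I s -> dot (N s) (N s) = 1.
Proof.
move=> Is; rewrite dotZl dotZr -sqr_enorm -/(kappa s) mulrA -expr2 -exprMn.
by rewrite mulVf ?expr1n // curvature_neq0.
Qed.

(** Differentiating a constant inner product is the source of the orthogonality relations T.N = 0
    and B'.B = 0. *)
Let dot_derive_cst (u v : R -> 'rV[R]_3) (c : R) du dv s :
  (forall x, I x -> dot (u x) (v x) = c) -> I s ->
  is_derive s 1 u du -> is_derive s 1 v dv ->
  dot du (v s) + dot (u s) dv = 0.
Proof.
move=> uvc Is us vs; rewrite -(is_derive_derive1 (is_derive_dot us vs)).
apply: is_derive_derive1.
apply: (eq_is_derive openI _ Is (is_derive_cst c s 1)) => x /set_mem Ix.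
by rewrite uvc.
Qed.

Lemma is_derive_tangent s : I s -> is_derive s 1 T (kappa s *: N s).
Proof.
move=> Is; have Ts := derivable_is_derive1 (@smoothT 0 s Is).
exact: is_derive_eq Ts (derive1_tangent Is).
Qed.

(** Differentiating T.T = 1 gives 2 kappa T.N = 0, and kappa is nonzero. *)
Lemma dot_tangent_normal s : I s -> dot (T s) (N s) = 0.
Proof.
move=> Is; have Ts := is_derive_tangent Is.
have := dot_derive_cst dot_tangent Is Ts Ts.
rewrite dotZl dotZr [dot (N s) _]dotC -mulr2n => /eqP.
by rewrite mulrn_eq0 /= mulf_eq0 (negPf (curvature_neq0 Is)) => /eqP.
Qed.

(** As T' is parallel to N, B' = T x N' is orthogonal to T; as B is a unit vector, B' is orthogonal
    to B. Only the N component is left, and it is - tau by definition of [torsion]. *)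
Lemma is_derive_binormal s : I s -> is_derive s 1 B (- tau s *: N s).
Proof.
move=> Is; have Bs := is_derive_closure smoothB Is.
have Ns := is_derive_closure smoothN Is.
have BTN : B^`() s = cross (T s) (derive1 N s).
  have := is_derive_derive1 (is_derive_cross (is_derive_tangent Is) Ns).
  by rewrite crossZl crossvv scaler0 add0r.
have BT : dot (derive1 B s) (T s) = 0 by rewrite BTN dot_crossl.
have BB : dot (derive1 B s) (B s) = 0.
  have BB1 x : I x -> dot (B x) (B x) = 1.
    move=> Ix; rewrite dot_cross_cross dot_tangent // dot_normal //.
    by rewrite dot_tangent_normal // expr0n subr0 mulr1.
  have /eqP := dot_derive_cst BB1 Is Bs Bs.
  by rewrite [dot (B s) _]dotC -mulr2n mulrn_eq0 /= => /eqP.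
suff <- : B^`() s = - tau s *: N s by [].
have := orthonormal_expansion (dot_tangent Is) (dot_normal Is)
  (dot_tangent_normal Is) (derive1 B s).
by rewrite /frame_comb BT -/(B s) BB !scale0r add0r addr0 opprK.
Qed.

(** N = B x T on [I], so the product rule reduces the claim to the known derivatives of B and T. *)
Lemma is_derive_normal s :
  I s -> is_derive s 1 N (- kappa s *: T s + tau s *: B s).
Proof.
move=> Is; have NBT : {in I, (fun x => cross (B x) (T x)) =1 N}.
  move=> x /set_mem Ix; rewrite cross_crossl dot_tangent // scale1r.
  by rewrite [dot (N x) _]dotC dot_tangent_normal // scale0r subr0.
apply: (eq_is_derive openI NBT Is).
apply: is_derive_eq
  (is_derive_cross (is_derive_binormal Is) (is_derive_tangent Is)) _.
rewrite crossZl [cross (N s) _]crossC -/(B s) scalerN scaleNr opprK addrC.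
congr (_ + _); rewrite crossC crossZl cross_crossr dot_normal //.
rewrite [dot (N s) _]dotC dot_tangent_normal // scale1r scale0r subr0.
by rewrite scaleNr.
Qed.


(** The three Frenet equations packed into one rule on coefficients: differentiate them and add the
    action of the skew-symmetric Frenet matrix. Differentiating a curve expressed in the frame
    becomes scalar algebra. *)
Lemma is_derive_frame_comb (a b c : R -> R) da db dc s : I s ->
  is_derive s 1 a da -> is_derive s 1 b db -> is_derive s 1 c dc ->
  is_derive s 1 (fun x => frame_comb (T x) (N x) (a x) (b x) (c x))
    (frame_comb (T s) (N s) (da - kappa s * b s)
      (db + kappa s * a s - tau s * c s)
      (dc + tau s * b s)).
Proof.
move=> Is as_ bs cs; have aT := is_derive_scalef as_ (is_derive_tangent Is).
have bN := is_derive_scalef bs (is_derive_normal Is).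
have cB := is_derive_scalef cs (is_derive_binormal Is).
apply: is_derive_eq (is_derive_addf (is_derive_addf aT bN) cB) _.
rewrite /frame_comb -/(B s); move: (T s) (N s) (B s) => u v w.
by apply: row3P; rewrite !(coordD, coordZ); ring.
Qed.


(** * Derivatives of the associated curve in the Frenet frame *)

Variables (lambda : R -> R) (alphas : R -> 'rV[R]_3).
Hypothesis smooth_lambda : smooth_on I lambda.
Hypothesis alphasE : forall s, I s -> alphas s = alpha s + lambda s *: B s.

Local Notation l := lambda.
Local Notation l1 := (derive1 lambda).
Local Notation l2 := (derive1n 2 lambda).
Local Notation l3 := (derive1n 3 lambda).
Local Notation k1 := (derive1 kappa).
Local Notation t1 := (derive1 tau).
Local Notation t2 := (derive1n 2 tau).

Let is_derive_lambda n s :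
  I s -> is_derive s 1 (derive1n n lambda) (derive1n n.+1 lambda s).
Proof. by move=> Is; apply: derivable_is_derive1; exact: smooth_lambda. Qed.

Let is_derive_curvature s : I s -> is_derive s 1 kappa (k1 s).
Proof. exact/smooth_closure_is_derive1/smooth_curvature. Qed.

Let is_derive_torsion s : I s -> is_derive s 1 tau (t1 s).
Proof. exact/smooth_closure_is_derive1/smooth_torsion. Qed.

Let is_derive_torsion1 s : I s -> is_derive s 1 t1 (t2 s).
Proof.
exact/smooth_closure_is_derive1/smooth_closure_derive1/smooth_torsion.
Qed.

Lemma derive1_associated s : I s ->
  derive1 alphas s = frame_comb (T s) (N s) 1 (- (l s * tau s)) (l1 s).
Proof.
move=> Is; have alphaT := derivable_is_derive1 (usfc_smooth alphaF (n := 0) Is).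
have lB := is_derive_scalef (is_derive_lambda 0 Is) (is_derive_binormal Is).
have sumE : {in I, (fun x => alpha x + l x *: B x) =1 alphas}.
  by move=> x /set_mem Ix; rewrite alphasE.
have sumD := eq_is_derive openI sumE Is (is_derive_addf alphaT lB).
rewrite (is_derive_derive1 sumD) /frame_comb scale1r scalerA mulrN -addrA.
by congr (_ + _); exact: addrC.
Qed.

Lemma derive2_associated s : I s ->
  derive1n 2 alphas s = frame_comb (T s) (N s) (l s * tau s * kappa s)
    (kappa s - l s * t1 s - 2 * (l1 s * tau s)) (l2 s - l s * tau s ^+ 2).
Proof.
move=> Is; apply: is_derive_derive1.
(* The formula for the first derivative holds on the whole open set [I], hence it can be
   differentiated once more. *)
have d1E : {in I, (fun x => frame_comb (T x) (N x)
    1 (- (l x * tau x)) (l1 x)) =1 derive1 alphas}.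
  by move=> x /set_mem Ix; rewrite derive1_associated.
apply: (eq_is_derive openI d1E Is).
have lt := is_derive_mulf (is_derive_lambda 0 Is) (is_derive_torsion Is).
have d1 : is_derive s 1 (fun=> 1 : R) 0 by exact: is_derive_cst.
have dNlt := is_derive_oppf lt.
apply: is_derive_eq (is_derive_frame_comb Is d1 dNlt (is_derive_lambda 1 Is)) _.
by congr frame_comb; rewrite /=; ring.
Qed.

(** The three coefficients are the factors that multiply X, Y and Z in the torsion formula. *)
Lemma derive3_associated s : I s ->
  derive1n 3 alphas s = frame_comb (T s) (N s)
    (l s * tau s * k1 s + 2 * l s * t1 s * kappa s
       + 3 * l1 s * tau s * kappa s - kappa s ^+ 2)
    (l s * tau s * kappa s ^+ 2 + l s * tau s ^+ 3 - l s * t2 s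
       - 3 * l2 s * tau s - 3 * l1 s * t1 s + k1 s)
    (- 3 * l s * tau s * t1 s - 3 * l1 s * tau s ^+ 2 + kappa s * tau s + l3 s).
Proof.
move=> Is; apply: is_derive_derive1.
(* The square of [tau] is spelled as a product to fit [is_derive_mulf]. *)
have d2E : {in I, (fun x => frame_comb (T x) (N x) (l x * tau x * kappa x)
    (kappa x - l x * t1 x - 2 * (l1 x * tau x)) (l2 x - l x * (tau x * tau x)))
    =1 derive1n 2 alphas}.
  by move=> x /set_mem Ix; rewrite derive2_associated // expr2.
apply: (eq_is_derive openI d2E Is).
have dl : is_derive s 1 l (l1 s) := is_derive_lambda 0 Is.
have dl1 : is_derive s 1 l1 (l2 s) := is_derive_lambda 1 Is.
have dl2 := is_derive_lambda 2 Is; have dk := is_derive_curvature Is.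
have dt := is_derive_torsion Is; have dt1 := is_derive_torsion1 Is.
have da := is_derive_mulf (is_derive_mulf dl dt) dk.
have d2 : is_derive s 1 (fun=> 2 : R) 0 by exact: is_derive_cst.
have db := is_derive_subf (is_derive_subf dk (is_derive_mulf dl dt1))
  (is_derive_mulf d2 (is_derive_mulf dl1 dt)).
have dc := is_derive_subf dl2 (is_derive_mulf dl (is_derive_mulf dt dt)).
apply: is_derive_eq (is_derive_frame_comb Is da db dc) _.
move: (l s) (l1 s) (l2 s) (l3 s) (kappa s) (k1 s) (tau s) (t1 s) (t2 s).
by move=> *; congr frame_comb; ring.
Qed.

(** The coefficients are arranged exactly as X, Y and Z of the theorem. *)
Lemma reg_cross_associated s : I s ->
  reg_cross alphas s = frame_comb (T s) (N s)
    (- l s * tau s * (- l s * tau s ^+ 2 + l2 s)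
       - l1 s * (- l s * t1 s - 2 * l1 s * tau s + kappa s))
    (l s * tau s ^+ 2 - l2 s + l1 s * l s * tau s * kappa s)
    (- l s * t1 s - 2 * l1 s * tau s + kappa s
       + l s ^+ 2 * tau s ^+ 2 * kappa s).
Proof.
move=> Is; rewrite /reg_cross derive1_associated // derive2_associated //.
rewrite cross_frame_comb ?(dot_tangent, dot_normal, dot_tangent_normal) //.
by congr frame_comb; ring.
Qed.

End FrenetFrame.

(** * The direction condition and the two formulas *)

(** The velocity is orthogonal to [reg_cross], so each pairing keeps a single term of [Rstar], in
    which a squared norm is divided by that norm. *)
Lemma dot_Rstar (R : realType) (beta : R -> 'rV[R]_3) (e f s : R) :
  derive1 beta s != 0 -> reg_cross beta s != 0 ->
  (dot (Rstar beta e f s) (derive1 beta s)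
     = e * enorm (derive1 beta s) / Num.sqrt (e ^+ 2 + f ^+ 2)) *
  (dot (Rstar beta e f s) (reg_cross beta s)
     = f * enorm (reg_cross beta s) / Num.sqrt (e ^+ 2 + f ^+ 2)).
Proof.
move=> d0 c0; have := enorm_gt0 d0; have := enorm_gt0 c0.
rewrite /Rstar /reg_tangent /reg_binormal => /lt0r_neq0 cn0 /lt0r_neq0 dn0.
rewrite !(dotZl, dotDl) [dot (derive1 beta s) (reg_cross beta s)]dotC.
rewrite dot_crossl -!sqr_enorm; set r := (Num.sqrt _)^-1.
by split; field; rewrite ?cn0 ?dn0.
Qed.

Unset Implicit Arguments.

Theorem theorem5p6 (R : realType) (I : set R) (e f : R)
    (alpha alphas : R -> 'rV[R]_3) (lambda : R -> R)
    (hI : open_interval I)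
    (hef : (e != 0) || (f != 0))
    (halpha : unit_speed_frenet_curve alpha I)
    (hassoc : BRstar_associated I e f alpha lambda alphas)
    (s : R) (hs : I s) :
  let kappa : R -> R := curvature alpha in
  let tau : R -> R := torsion alpha in
  let l : R := lambda s in
  let l1 : R := lambda^`() s in
  let l2 : R := lambda^`(2) s in
  let l3 : R := lambda^`(3) s in
  let k : R := kappa s in
  let k1 : R := kappa^`() s in
  let t : R := tau s in
  let t1 : R := tau^`() s in
  let t2 : R := tau^`(2) s in
  let X : R :=
    - l * t * (- l * t ^+ 2 + l2) - l1 * (- l * t1 - 2 * l1 * t + k) in
  let Y : R := l * t ^+ 2 - l2 + l1 * l * t * k in
  let Z : R := - l * t1 - 2 * l1 * t + k + l ^+ 2 * t ^+ 2 * k in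
  (f * (e ^+ 2 + f ^+ 2) * l1 ^+ 3 != 0 ->
    reg_curvature alphas s
      = (Z * e ^+ 3) / (f * (e ^+ 2 + f ^+ 2) * l1 ^+ 3)) /\
  (Z ^+ 2 * (e ^+ 2 + f ^+ 2) != 0 ->
    reg_torsion alphas s
      = f ^+ 2 / (Z ^+ 2 * (e ^+ 2 + f ^+ 2)) *
        (X * (l * t * k1 + 2 * l * t1 * k + 3 * l1 * t * k - k ^+ 2)
         + Y * (l * t * k ^+ 2 + l * t ^+ 3 - l * t2 - 3 * l2 * t
                - 3 * l1 * t1 + k1)
         + Z * (- 3 * l * t * t1 - 3 * l1 * t ^+ 2 + k * t + l3))).
Proof.
move=> kappa tau l l1 l2 l3 k k1 t t1 t2 X Y Z.
case: hI => openI _; case: hassoc => smooth_l alphasE [d0 c0] dirE.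
have TT := dot_tangent halpha hs.
have NN := dot_normal halpha hs.
have TN := dot_tangent_normal openI halpha hs.
have d1E := derive1_associated openI halpha smooth_l alphasE hs.
have d3E := derive3_associated openI halpha smooth_l alphasE hs.
have cE : reg_cross alphas s
    = frame_comb (tangent alpha s) (normal alpha s) X Y Z.
  exact: (reg_cross_associated openI halpha smooth_l alphasE hs).
(* In this form, pairing with the binormal reads off the third coefficient. *)
have BE : binormal alpha s
    = frame_comb (tangent alpha s) (normal alpha s) 0 0 1.
  by rewrite /frame_comb !scale0r !add0r scale1r.
pose r := Num.sqrt (e ^+ 2 + f ^+ 2).
pose n1 := enorm (derive1 alphas s); pose n2 := enorm (reg_cross alphas s).
have n1_neq0 : n1 != 0 by rewrite gt_eqF // enorm_gt0 // d0.
have n2_neq0 : n2 != 0 by rewrite gt_eqF // enorm_gt0 // c0.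
(* The product of the velocity with B = R* is evaluated twice: by [dot_Rstar], and in the Frenet
   frame. [ZE] does the same with [reg_cross]. *)
have l1E : l1 = e * n1 / r.
  have <- := (dot_Rstar e f (d0 s hs) (c0 s hs)).1.
  by rewrite -dirE // BE d1E dot_frame_comb // !mul0r !add0r mul1r.
have ZE : Z = f * n2 / r.
  have <- := (dot_Rstar e f (d0 s hs) (c0 s hs)).2.
  by rewrite -dirE // BE cE dot_frame_comb // !mul0r !add0r mul1r.
have r2 : e ^+ 2 + f ^+ 2 = r ^+ 2.
  by rewrite sqr_sqrtr // addr_ge0 // sqr_ge0.
have r_neq0 : r != 0.
  apply: contraTneq hef => r0; move: r2; rewrite r0 expr0n => /eqP.
  by rewrite paddr_eq0 ?sqr_ge0 // !sqrf_eq0 => /andP[-> ->].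
rewrite /reg_curvature /reg_torsion -/n1 -/n2 r2; split=> [den|den].
  (* The nonzero denominator contains lambda', a multiple of e, so it excludes e = 0; the powers of
     e, f and r then cancel, leaving n2 / n1 ^ 3. *)
  have e_neq0 : e != 0.
    by apply: contraNneq den => e0; rewrite l1E e0 !(mul0r, expr0n, mulr0).
  have f_neq0 : f != 0 by apply: contraNneq den => f0; rewrite f0 !mul0r.
  by rewrite l1E ZE; field; rewrite n1_neq0 r_neq0 e_neq0 f_neq0.
have f_neq0 : f != 0.
  by apply: contraNneq den => f0; rewrite ZE f0 !(mul0r, expr0n).
(* The bracket is now the inner product of the coefficients; what remains is 1 / n2 ^ 2 = f ^ 2 / (Z
   ^ 2 r ^ 2), which is [ZE] squared. *)
rewrite cE d3E dot_frame_comb // mulrC; congr (_ * _).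
by rewrite ZE; field; rewrite n2_neq0 r_neq0 f_neq0.
Qed.
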